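(* Let $n\ge2$ and $M_n=\frac12 n(n-1)$. Let $X$ be a vector space over $\mathbb{K}$ and let $(Y,\|\cdot\|)$ be a normed space over $\mathbb{K}$, where $\mathbb{K}=\mathbb{R}$ or $\mathbb{K}=\mathbb{C}$. Any $M_n$-linear and symmetric map $A:X^{M_n}\to Y$ defines a pseudo $n$-metric on $X$ via $$d(x_1,\ldots,x_n)=\Big\|A\Big(\prod_{1\le j<i\le n}(x_i-x_j)\Big)\Big\|,\qquad x_1,\ldots,x_n\in X.$$
   Context: Notation: since $A$ is symmetric, its list of $M_n$ arguments is written as a formal product; $A\big(\prod_{1\le j<i\le n}(x_i-x_j)\big)$ denotes the value of $A$ at the $M_n$ vectors $x_i-x_j$, $1\le j<i\le n$, in any order. Let $X$ be a set and $n\ge 2$. A map $d:X^n\to\mathbb{R}$ is a pseudo $n$-metric on $X$ if: (M1, semidefiniteness) if $x_i=x_j$ for some $i\ne j$, then $d(x_1,\ldots,x_n)=0$; (M2, symmetry) $d(x_{\pi(1)},\ldots,x_{\pi(n)})=d(x_1,\ldots,x_n)$ for all $x\in X^n$ and all permutations $\pi$ of $\{1,\ldots,n\}$; (M3, simplex inequality) $d(x_1,\ldots,x_n)\le\sum_{i=1}^n d(x_1,\ldots,x_{i-1},y,x_{i+1},\ldots,x_n)$ for all $x_1,\ldots,x_n,y\in X$. *)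

(* Defs.v *)
From HB Require Import structures.
From mathcomp Require Import all_boot all_order all_fingroup all_algebra.
From mathcomp Require Import complex.
From mathcomp Require Import reals normedtype.

Set Implicit Arguments.
Unset Strict Implicit.
Unset Printing Implicit Defensive.

Import Order.TTheory GRing.Theory Num.Theory.
Import numFieldNormedType.Exports.

Local Open Scope ring_scope.

(* Points of X^m are finite functions (X ^ m)%type = {ffun 'I_m -> X}, with
   indices running over 0, ..., m - 1 instead of 1, ..., m. *)

Definition replace (m : nat) (X : Type) (x : X ^ m) (i : 'I_m) (y : X)
  : (X ^ m)%type := [ffun k => if k == i then y else x k].

Definition symmetric_map (m : nat) (X Z : Type) (f : X ^ m -> Z) : Prop :=
  forall (s : 'S_m) (x : X ^ m), f [ffun k => x (s k)] = f x.

Definition multilinear (m : nat) (K : pzRingType) (X Y : lmodType K)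
    (A : X ^ m -> Y) : Prop :=
  forall (i : 'I_m) (x : X ^ m), linear (fun v : X => A (replace x i v)).

Record pseudo_nmetric (R : realType) (n : nat) (X : Type) (d : X ^ n -> R)
  : Prop := PseudoNMetric {
  pseudo_nmetric_semidefinite :
    forall (x : X ^ n) (i j : 'I_n), i <> j -> x i = x j -> d x = 0;
  pseudo_nmetric_symmetric : symmetric_map d;
  pseudo_nmetric_simplex :
    forall (x : X ^ n) (y : X), d x <= \sum_(i < n) d (replace x i y)
}.

Variant scalars := RealScalars | ComplexScalars.

Definition scalar_field (R : realType) (k : scalars) : numFieldType :=
  match k with RealScalars => R | ComplexScalars => R[i] end.

Definition scalar_re (R : realType) (k : scalars) : scalar_field R k -> R :=
  match k with RealScalars => id | ComplexScalars => @complex.Re R end.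

(* In a normedModType K the norm `|y| is a nonnegative element of K; for
   K = R[i] it therefore has imaginary part 0, and its real part is the
   usual real-valued norm. *)
Definition real_norm (R : realType) (k : scalars)
  (Y : normedModType (scalar_field R k)) (y : Y) : R := scalar_re `|y|.

Definition npairs (n : nat) : nat := ((n * (n - 1))./2)%N.

Definition ordered_pair (n : nat) : finType :=
  {p : 'I_n * 'I_n | (p.2 < p.1)%N}.

Lemma card_ordered_pair (n : nat) : #|ordered_pair n| = npairs n.
Proof.
rewrite /npairs subn1 -bin2 -bin2_sum card_sig -sum1_card.
rewrite (eq_bigl (fun p : 'I_n * 'I_n => true && (p.2 < p.1)%N)) //.
rewrite -(pair_big_dep xpredT (fun i j : 'I_n => (j < i)%N) (fun _ _ => 1%N)) /=.
rewrite big_mkord; apply: eq_bigr => i _.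
by rewrite -(big_ord_widen n (fun=> 1%N)) ?sum1_card ?card_ord // ltnW.
Qed.

Definition nth_pair (n : nat) (k : 'I_(npairs n)) : ordered_pair n :=
  enum_val (cast_ord (esym (card_ordered_pair n)) k).

Definition difference (n : nat) (X : zmodType) (x : X ^ n)
  (p : ordered_pair n) : X := x (val p).1 - x (val p).2.

Definition differences (n : nat) (X : zmodType) (x : X ^ n)
  : (X ^ npairs n)%type := [ffun k => difference x (nth_pair k)].

(* The order in which the pairs are enumerated is immaterial for a
   symmetric map. *)
Lemma symmetric_differences (n : nat) (X : zmodType) (Z : Type)
    (A : X ^ npairs n -> Z) (e : 'I_(npairs n) -> ordered_pair n) (x : X ^ n) :
  symmetric_map A -> bijective e ->
  A [ffun k => difference x (e k)] = A (differences x).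
Proof.
move=> symA /bij_inj e_inj.
pose g (p : ordered_pair n) := cast_ord (card_ordered_pair n) (enum_rank p).
have gK p : nth_pair (g p) = p by rewrite /nth_pair cast_ordK enum_rankK.
have inj_s : injective (g \o e) by apply: inj_comp e_inj; apply: can_inj gK.
rewrite -(symA (perm inj_s) (differences x)); congr A.
by apply/ffunP => k; rewrite !ffunE permE /= gK.
Qed.

(* Main.v *)
(** In a commutative ring, replacing the [i]-th column of the Vandermonde matrix
    of [t] by the powers of [y] and summing the determinants over [i] gives back
    the Vandermonde determinant of [t] (Lagrange interpolation of the constant 1).
    A symmetric multilinear map [A] and vectors [z_i] induce a linear map on
    homogeneous polynomials sending the product of the [X_(f k)] to
    [A (z_(f k))_k], hence sending the Vandermonde determinant of the [X_i] to the
    value of [A] at all differences of the [z_i].  So [A] inherits the identities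
    of Vandermonde determinants, and the simplex inequality is the triangle
    inequality in [Y]. *)

Require Import Defs.
From HB Require Import structures.
From mathcomp Require Import all_boot all_order all_fingroup all_algebra.
From mathcomp Require Import complex.
From mathcomp Require Import reals normedtype.
(* The notations of mpoly clash with those of normedtype. *)
From mathcomp Require Import -(notations) mpoly.

Set Implicit Arguments.
Unset Strict Implicit.
Unset Printing Implicit Defensive.

Import Order.TTheory GRing.Theory Num.Theory.

(** * Vandermonde determinants and column replacement *)

(** Expansion along the replaced column gives entries of [\adj V]. Row [0] of [V] consists of ones,
    so summing them over [i] yields row [0] of [V *m \adj V], which is [\det V] in column [0] and
    zero elsewhere. *)
Lemma det_replace_col_sum (K : comPzRingType) (n : nat) (V : 'M[K]_n.+1)
    (c : 'cV[K]_n.+1) :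
  (forall i, V ord0 i = 1)%R ->
  (\sum_(i < n.+1) \det (\matrix_(r, j) if j == i then c r ord0 else V r j)
   = c ord0 ord0 * \det V)%R.
Proof.
move=> V0.
have colE i : (\det (\matrix_(r, j) if j == i then c r ord0 else V r j)
    = \sum_r c r ord0 * \adj V i r)%R.
  rewrite (expand_det_col _ i); apply: eq_bigr => r _.
  rewrite !mxE eqxx; congr (_ * (_ * \det _))%R.
  by apply/matrixP => a b; rewrite !mxE eq_sym (negbTE (neq_lift _ _)).
under eq_bigr => i _ do rewrite colE.
rewrite exchange_big /= (bigD1 ord0) //= [X in (_ + X)%R]big1 => [|r r_neq0].
  have := congr1 (fun M : 'M__ => M ord0 ord0) (mul_mx_adj V).
  rewrite !mxE eqxx mulr1n addr0 -mulr_sumr => <-.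
  by congr (_ * _)%R; apply: eq_bigr => i _; rewrite V0 mul1r.
have := congr1 (fun M : 'M__ => M ord0 r) (mul_mx_adj V).
rewrite !mxE eq_sym (negbTE r_neq0) mulr0n -mulr_sumr => adj0.
rewrite -[X in (_ * X)%R](_ : 0 = _)%R ?mulr0 // -[LHS]adj0.
by apply: eq_bigr => i _; rewrite V0 mul1r.
Qed.

Definition vandermonde (K : pzRingType) (n : nat) (t : K ^ n) : 'M[K]_n :=
  Vandermonde n (\row_j t j).

Lemma det_vandermonde (K : comPzRingType) (n : nat) (t : K ^ n) :
  (\det (vandermonde t) = \prod_(k < npairs n) differences t k)%R.
Proof.
rewrite det_Vandermonde.
under eq_bigr => i _ do under eq_bigr => j _ do rewrite !mxE.
have e_bij : bijective (@nth_pair n).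
  apply: inj_card_bij; last by rewrite card_ord card_ordered_pair.
  exact/(inj_comp enum_val_inj)/cast_ord_inj.
under [RHS]eq_bigr => k _ do rewrite ffunE.
rewrite -(reindex _ (onW_bij _ e_bij) (P := xpredT) (F := difference t)) /=.
(* The product comes with the smaller index outside, while [ordered_pair] puts the larger one
   first. *)
rewrite (exchange_big_dep xpredT) //= pair_big_dep /=.
rewrite (reindex_omap (val : ordered_pair n -> _) insub) /=; last first.
  by move=> p lt_p; rewrite insubT.
by apply: eq_bigl => p; rewrite (valP p) valK eqxx.
Qed.

(** The column of powers of [y] has top entry [y ^+ 0 = 1]. For [n = 0] the sum is empty but the
    determinant is 1. *)
Lemma vandermonde_replace (K : comPzRingType) (n : nat) (t : K ^ n) (y : K) :
  (0 < n)%N ->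
  (\sum_(i < n) \det (vandermonde (replace t i y)) = \det (vandermonde t))%R.
Proof.
case: n t => // n t _.
transitivity ((\col_r y ^+ r : 'cV__) (@ord0 n) (@ord0 0)
    * \det (vandermonde t))%R.
  rewrite -det_replace_col_sum => [|i]; last by rewrite !mxE.
  apply: eq_bigr => i _; congr (\det _)%R; apply/matrixP => r j.
  by rewrite !mxE ffunE; case: eqP.
by rewrite mxE mul1r.
Qed.

Lemma vandermonde_alternate (K : comPzRingType) (n : nat) (t : K ^ n)
    (i j : 'I_n) :
  i <> j -> t i = t j -> (\det (vandermonde t) = 0)%R.
Proof.
move=> /eqP neq_ij eq_t; rewrite -det_tr.
by apply: (determinant_alternate neq_ij) => r; rewrite !mxE eq_t.
Qed.

Lemma vandermonde_perm (K : comPzRingType) (n : nat) (t : K ^ n) (s : 'S_n) :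
  (\det (vandermonde [ffun i => t (s i)]) = (-1) ^+ s * \det (vandermonde t))%R.
Proof.
have -> : vandermonde [ffun i => t (s i)] = col_perm s (vandermonde t).
  by apply/matrixP => r j; rewrite !mxE ffunE.
by rewrite col_permE det_mulmx det_perm odd_permV mulrC.
Qed.

(** * Transfer from symmetric multilinear maps to polynomials *)

(** Stated for additive groups, so that it covers both [A] and an additive map applied to a product
    of polynomials. *)
Definition subtractive (m : nat) (X Y : zmodType) (A : X ^ m -> Y) : Prop :=
  forall (i : 'I_m) (x : X ^ m) (u v : X),
    A (replace x i (u - v)%R) = (A (replace x i u) - A (replace x i v))%R.

(** Expanding all differences turns both sides into the same signed sum of values at plain vectors;
    this is done one slot at a time. *)
Lemma eq_subtractive (m : nat) (X V Y : zmodType) (A : X ^ m -> Y)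
    (B : V ^ m -> Y) (I : Type) (b : I -> X) (c : I -> V) :
  subtractive A -> subtractive B ->
  (forall f : 'I_m -> I, A [ffun k => b (f k)] = B [ffun k => c (f k)]) ->
  forall f h : 'I_m -> I,
    A [ffun k => b (f k) - b (h k)]%R = B [ffun k => c (f k) - c (h k)]%R.
Proof.
move=> subA subB eqAB.
(* Slots below [j] hold differences, the others plain vectors. *)
pose mix (W : zmodType) (w : I -> W) j (f h : 'I_m -> I) : (W ^ m)%type :=
  [ffun k : 'I_m => if (k < j)%N then w (f k) - w (h k) else w (f k)]%R.
have mixS (W : zmodType) (w : I -> W) (C : W ^ m -> Y) (j : 'I_m) f h :
    subtractive C ->
    C (mix W w j.+1 f h)
    = (C (mix W w j f h)
       - C (mix W w j (fun k => if k == j then h k else f k) h))%R.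
  move=> subC; pose x := mix W w j f h.
  have -> : mix W w j.+1 f h = replace x j (w (f j) - w (h j))%R.
    apply/ffunP => k; rewrite !ffunE ltnS leq_eqVlt.
    by case: (eqVneq k j) => [->|kj]; rewrite ?eqxx //
      (negbTE (kj : k != j :> nat)).
  rewrite subC; congr (C _ - C _)%R; apply/ffunP => k; rewrite !ffunE;
    by case: (eqVneq k j) => [->|_]; rewrite ?ltnn.
(* Expanding a slot replaces [f] by [h] there in one of the two terms, so the induction keeps [f]
   general. *)
suff eq_mix j : (j <= m)%N -> forall f h, A (mix X b j f h) = B (mix V c j f h).
  move=> f h; have := eq_mix m (leqnn m) f h.
  by congr (A _ = B _); apply/ffunP => k; rewrite !ffunE ltn_ord.
elim: j => [_ f h|j IHj lt_jm f h].
  by have := eqAB f; congr (A _ = B _); apply/ffunP => k; rewrite !ffunE.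
have {}IHj := IHj (ltnW lt_jm).
by rewrite (mixS _ _ _ (Ordinal lt_jm)) // (mixS _ _ B (Ordinal lt_jm)) // !IHj.
Qed.

Lemma multilinear_subtractive (m : nat) (K : pzRingType) (X Y : lmodType K)
    (A : X ^ m -> Y) : multilinear A -> subtractive A.
Proof.
move=> linA i x u v; rewrite [(u - v)%R]addrC [RHS]addrC.
by have /= := linA i x (-1)%R v u; rewrite !scaleN1r.
Qed.

(** The exponent of [i] counts the [k] with [f k = i], so equal monomials make [f] a rearrangement
    of [h]. This makes the map on monomials well defined. *)
Lemma symmetric_map_count (m N : nat) (X Z : Type) (A : X ^ m -> Z)
    (z : 'I_N -> X) (f h : 'I_m -> 'I_N) :
  symmetric_map A ->
  (\big[mnm_add/mnm0]_(k < m) mnm1 (f k)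
   = \big[mnm_add/mnm0]_(k < m) mnm1 (h k)) ->
  A [ffun k => z (f k)] = A [ffun k => z (h k)].
Proof.
move=> symA eq_fh.
have countE g (i : 'I_N) : count_mem i (mktuple g)
    = (\big[mnm_add/mnm0]_(k < m) mnm1 (g k)) i :> nat.
  rewrite mnm_sumE /= count_map -sum1_count big_mkcond big_enum /=.
  by apply: eq_bigr => k _; rewrite mnm1E /=; case: eqP.
have /tuple_permP[s eq_s] : perm_eq (mktuple f) (mktuple h).
  by apply/allP => i _; rewrite /= !countE eq_fh.
rewrite -(symA s [ffun k => z (h k)]); congr A; apply/ffunP => k.
rewrite !ffunE; congr z.
have := congr1 (fun t => tnth t k) (val_inj eq_s : mktuple f = _).
by rewrite !tnth_mktuple.
Qed.

Lemma prod_subtractive (m : nat) (K : comPzRingType) (Y : zmodType)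
    (L : {additive K -> Y}) :
  subtractive (fun x : K ^ m => L (\prod_(k < m) x k)%R).
Proof.
move=> i x u v; rewrite -raddfB; congr (L _).
have prodE w : (\prod_(k < m) replace x i w k
    = w * \prod_(k < m | k != i) x k)%R.
  rewrite (bigD1 i) //= ffunE eqxx; congr (_ * _)%R.
  by apply: eq_bigr => k /negbTE ki; rewrite ffunE ki.
by rewrite !prodE mulrBl.
Qed.

Lemma polynomial_transfer (m N : nat) (K : comNzRingType) (X Y : lmodType K)
    (A : X ^ m -> Y) (z : 'I_N -> X) :
  symmetric_map A ->
  exists L : {linear mpoly N K -> Y}, forall f : 'I_m -> 'I_N,
    A [ffun k => z (f k)] = L (\prod_(k < m) mpolyX K (mnm1 (f k)))%R.
Proof.
move=> symA.
pose mon (f : 'I_m -> 'I_N) := \big[mnm_add/mnm0]_(k < m) mnm1 (f k).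
(* Any [f] with monomial [u] will do; monomials of degree other than [m] get the default 0. *)
pose a (u : multinom N) : Y :=
  if [pick f : {ffun 'I_m -> 'I_N} | mon f == u] is Some f
  then A [ffun k => z (f k)] else 0%R.
(* A fixed range, the monomials of degree at most [m], makes linearity immediate. *)
pose L (p : mpoly N K) : Y :=
  (\sum_(u : bmultinom N m.+1) mcoeff (bmnm u) p *: a (bmnm u))%R.
have linL : linear L.
  move=> c p q; rewrite /L scaler_sumr -big_split /=.
  by apply: eq_bigr => u _; rewrite mcoeffD mcoeffZ scalerDl scalerA.
pose LM := GRing.isLinear.Build _ _ _ _ L linL.
pose LL : {linear mpoly N K -> Y} := HB.pack L LM.
exists LL => f; rewrite mprodXE -/(mon f) /= /L.
have deg_f : (mdeg (mon f) < m.+1)%N.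
  by rewrite mdeg_sum (eq_bigr (fun=> 1%N)) => [|k _]; rewrite ?mdeg1 //
    sum1_card card_ord.
rewrite (bigD1 (BMultinom deg_f)) //= mcoeffX eqxx scale1r.
rewrite big1 ?addr0; last first.
  move=> u; rewrite -val_eqE /= => neq_u.
  by rewrite mcoeffX eq_sym (negbTE neq_u) scale0r.
rewrite /a; case: pickP => [h /eqP eq_h | /(_ (finfun f))].
  exact: (symmetric_map_count z symA (esym eq_h)).
by rewrite /mon; under eq_bigr do rewrite ffunE; rewrite eqxx.
Qed.

(** A single [L] serves all [g], so identities between determinants with repeated, permuted or
    exchanged variables carry over to [A]. *)
Lemma vandermonde_transfer (n N : nat) (K : comNzRingType) (X Y : lmodType K)
    (A : X ^ npairs n -> Y) (z : 'I_N -> X) :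
  multilinear A -> symmetric_map A ->
  exists L : {linear mpoly N K -> Y}, forall g : 'I_n -> 'I_N,
    A (differences [ffun i => z (g i)])
    = L (\det (vandermonde [ffun i => mpolyX K (mnm1 (g i))]))%R.
Proof.
move=> linA symA; have [L LE] := polynomial_transfer z symA; exists L => g.
rewrite det_vandermonde.
transitivity (A [ffun k => z (g (val (nth_pair k)).1)
                          - z (g (val (nth_pair k)).2)]%R).
  by congr A; apply/ffunP => k; rewrite !ffunE /difference !ffunE.
rewrite (eq_subtractive (multilinear_subtractive linA)
  (@prod_subtractive _ _ _ L) (c := fun i => mpolyX K (mnm1 i))) => [|f].
  by congr (L _); apply: eq_bigr => k _; rewrite !ffunE /difference !ffunE.
by rewrite LE; congr (L _); apply: eq_bigr => k _; rewrite ffunE.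
Qed.

(** * Vandermonde identities for [A] at differences *)

Lemma differences_alternate (n : nat) (K : comNzRingType) (X Y : lmodType K)
    (A : X ^ npairs n -> Y) (x : X ^ n) (i j : 'I_n) :
  multilinear A -> symmetric_map A -> i <> j -> x i = x j ->
  A (differences x) = 0%R.
Proof.
move=> linA symA neq_ij eq_x; have [L LE] := vandermonde_transfer x linA symA.
(* Redirecting [i] to [j] leaves [x] unchanged, since [x i = x j], but makes two columns of
   polynomials equal. *)
have := LE (fun k => if k == i then j else k).
rewrite (vandermonde_alternate neq_ij) ?raddf0.
  move=> <-; congr (A (differences _)); apply/ffunP => k; rewrite ffunE.
  by case: eqP => [->|].
by rewrite !ffunE eqxx; case: eqP.
Qed.

Lemma differences_perm (n : nat) (K : comNzRingType) (X Y : lmodType K)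
    (A : X ^ npairs n -> Y) (x : X ^ n) (s : 'S_n) :
  multilinear A -> symmetric_map A ->
  A (differences [ffun k => x (s k)]) = ((-1) ^+ s *: A (differences x))%R.
Proof.
move=> linA symA; have [L LE] := vandermonde_transfer x linA symA.
have xE : x = [ffun k => x k] by apply/ffunP => k; rewrite ffunE.
rewrite LE [in RHS]xE (LE id).
pose t : (mpoly n K ^ n)%type := [ffun i => mpolyX K (mnm1 i)].
rewrite -[X in vandermonde X](_ : [ffun k => t (s k)] = _).
  rewrite vandermonde_perm mulr_sign scaler_sign.
  by case: odd_perm; rewrite ?raddfN.
by apply/ffunP => k; rewrite !ffunE.
Qed.

Lemma differences_replace (n : nat) (K : comNzRingType) (X Y : lmodType K)
    (A : X ^ npairs n -> Y) (x : X ^ n) (y : X) :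
  (0 < n)%N -> multilinear A -> symmetric_map A ->
  A (differences x) = (\sum_(i < n) A (differences (replace x i y)))%R.
Proof.
move=> n_gt0 linA symA.
(* One extra variable, of index [ord0], stands for [y]; the variable [lift ord0 i] stands for
   [x i]. *)
pose z (i : 'I_n.+1) := oapp x y (unlift ord0 i).
have [L LE] := vandermonde_transfer z linA symA.
pose t : (mpoly n.+1 K ^ n)%type := [ffun i => mpolyX K (mnm1 (lift ord0 i))].
have -> : A (differences x) = L (\det (vandermonde t))%R.
  rewrite -LE; congr (A (differences _)); apply/ffunP => i.
  by rewrite ffunE /z liftK.
rewrite -(vandermonde_replace t (mpolyX K (mnm1 ord0))) // raddf_sum.
apply: eq_bigr => i _.
have := LE (fun k => if k == i then ord0 else lift ord0 k).
rewrite [X in A (differences X)](_ : _ = replace x i y); last first.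
  by apply/ffunP => k; rewrite !ffunE /z; case: eqP; rewrite ?unlift_none
    ?liftK.
move=> ->; congr (L (\det (vandermonde _)))%R.
by apply/ffunP => k; rewrite !ffunE; case: eqP.
Qed.

(** * The real-valued norm over both scalar fields *)

Lemma real_norm0 (R : realType) (k : scalars)
    (Y : normedModType (scalar_field R k)) : real_norm (0 : Y)%R = 0%R.
Proof. by rewrite /real_norm normr0; case: k Y. Qed.

Lemma real_norm_sign (R : realType) (k : scalars)
    (Y : normedModType (scalar_field R k)) (b : bool) (y : Y) :
  real_norm ((-1) ^+ b *: y)%R = real_norm y.
Proof. by rewrite /real_norm scaler_sign; case: b; rewrite ?normrN. Qed.

Lemma ler_real_norm_sum (R : realType) (k : scalars)
    (Y : normedModType (scalar_field R k)) (n : nat) (y : 'I_n -> Y) :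
  (real_norm (\sum_(i < n) y i) <= \sum_(i < n) real_norm (y i))%R.
Proof.
rewrite /real_norm; have := ler_norm_sum (index_enum 'I_n) y xpredT.
(* Over [R[i]] the inequality is one of complex numbers, which means equal imaginary parts and
   ordered real parts; the real part is additive. *)
case: k Y y => //= Y y; rewrite -raddf_sum.
by rewrite lecE => /andP[].
Qed.

Theorem corollary7 (R : realType) (k : scalars) (n : nat) (hn : (2 <= n)%N)
    (X : lmodType (scalar_field R k)) (Y : normedModType (scalar_field R k))
    (A : X ^ npairs n -> Y)
    (A_multilinear : multilinear A) (A_symmetric : symmetric_map A) :
  pseudo_nmetric (fun x : X ^ n => real_norm (A (differences x))).
Proof.
split=> [x i j neq_ij eq_x | s x | x y].
- rewrite (differences_alternate A_multilinear A_symmetric neq_ij eq_x).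
  exact: real_norm0.
- by rewrite differences_perm // real_norm_sign.
- rewrite (differences_replace x y _ A_multilinear) //; last exact: ltnW.
  exact: ler_real_norm_sum.
Qed.
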